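(* Let $\xi_{wsp}(n)$ denote the minimum number of triples in a weakly spreading linear triple system on $n$ vertices. Then $$n-3\leq \xi_{wsp}(n)<\tfrac{8}{3}n+o(n).$$
   Context: A linear triple system $\mathcal{F}$ on a vertex set $V$ is a family of 3-element subsets (triples) of $V$ any two of which share at most one element. For $V'\subseteq V$, the neighbourhood $N(V')$ is the set of all $z\in V\setminus V'$ for which there exist distinct $x,y\in V'$ with $\{x,y,z\}\in\mathcal{F}$. The closure $\mathrm{cl}(V')$ is the smallest set $W\supseteq V'$ with $N(W)=\emptyset$. For a subfamily $\mathcal{F}'\subseteq\mathcal{F}$, $V(\mathcal{F}')$ denotes the union of its triples. The system $\mathcal{F}$ is weakly spreading if $\mathrm{cl}(V(\mathcal{F}'))=V$ for every subfamily $\mathcal{F}'\subseteq\mathcal{F}$ with $|\mathcal{F}'|>1$.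
   Formalization: The minimum is taken over systems with at least two triples (the empty system is vacuously weakly spreading), and the lower bound n-3 is stated for n ≠ 6, since two disjoint triples on 6 vertices give ξ_wsp(6) = 2 < 3. *)

(* Defs.v *)
From HB Require Import structures.
From mathcomp Require Import all_boot all_order all_algebra.
From mathcomp Require Import constructive_ereal reals.

Set Implicit Arguments.
Unset Strict Implicit.
Unset Printing Implicit Defensive.

Import Order.TTheory GRing.Theory Num.Theory.

Local Open Scope ring_scope.

Section TripleSystems.
Variable T : finType.
Implicit Types (F G : {set {set T}}) (A W : {set T}).

Definition linear_triple_system F : bool :=
  [forall t in F, #|t| == 3%N] &&
  [forall t in F, forall u in F, (t != u) ==> (#|t :&: u| <= 1)%N].

Definition nbhd F A : {set T} :=
  [set z | (z \notin A) &&
    [exists x in A, exists y in A, (x != y) && ([set x; y; z] \in F)]].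

(* The smallest superset of A with empty neighbourhood, obtained as the
   intersection of all of them; see cl_closed and cl_min. *)
Definition cl F A : {set T} :=
  \bigcap_(W : {set T} | (A \subset W) && (nbhd F W == set0)) W.

(* V(F) is finset's cover F. *)
Definition weakly_spreading F : bool :=
  [forall G : {set {set T}},
    (G \subset F) && (1 < #|G|)%N ==> (cl F (cover G) == [set: T])].

Lemma sub_cl F A : A \subset cl F A.
Proof. by apply/bigcapsP => W /andP[]. Qed.

Lemma cl_min F A W : A \subset W -> nbhd F W = set0 -> cl F A \subset W.
Proof. by move=> AW W0; apply: bigcap_inf; rewrite AW W0 eqxx. Qed.

Lemma cl_closed F A : nbhd F (cl F A) = set0.
Proof.
apply/setP => z; rewrite !inE; apply/negP => /andP[/negP zA].
move=> /exists_inP[x xA /exists_inP[y yA /andP[xy xyz]]].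
apply: zA; apply/bigcapP => W /andP[AW /eqP W0]; apply/negPn/negP => zW.
have clW := subsetP (cl_min AW W0).
have : z \in nbhd F W.
  rewrite inE zW; apply/exists_inP; exists x; first exact: clW.
  by apply/exists_inP; exists y; [exact: clW | rewrite xy].
by rewrite W0 inE.
Qed.

End TripleSystems.

(* A family with at most one triple is weakly spreading only vacuously, so the
   minimum ranges over the families with more than one triple.  It is +oo when
   there are none, which is the case for n < 5.  For n = 6 it is 2, reached by
   two disjoint triples: this is the only n at which n - 3 fails to be a lower
   bound. *)
Definition xi_wsp (R : realType) (n : nat) : \bar R :=
  \big[Order.min/+oo%E]_(F : {set {set 'I_n}} |
      [&& linear_triple_system F, weakly_spreading F & (1 < #|F|)%N])
    (#|F|%:R)%:E.

(* Main.v *)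
(** Lower bound: start from two triples that meet, hence cover 5 vertices; every
vertex added by the closure process uses up a new triple.  If no two triples
meet, the union of two of them is already closed, so that there are 6 vertices.

Upper bound: about 2n triples suffice.  Let q be odd.  On the 4q + 2 hubs, the
points (i, x) of Z_4 x Z_q and two points at infinity, the lines are
{(i, x), (i, y), (i + 1, (x + y)/2 + 1)} for x <> y, and
{(i, x), (i + 1, x + 1), oo_(i mod 2)}.  Two hubs (i, x) and (i + 2, y) are on
no line.  Attach to some of these 2q^2 pairs {a, b} a new vertex v and
the triple {a, b, v}.  A set of hubs that is closed under lines and contains
either a line and another hub, or a pair (i, x), (i + 2, y) and another hub,
contains all hubs: if it has x <> y in layer i and some w off their midpoint in
layer i + 1, it is invariant under the nonzero translation obtained by composing
the reflections in w and in the midpoint, and this yields both points at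
infinity; these move (i, x) to (i + 1, x + 1) for all i, and as 4 is invertible
modulo q every point is reached.  Any two triples put the closure in
one of the two cases.  There are 2q(q - 1) + 4q lines, and the vertices other
than hubs contribute one triple each, while about 2q^2 vertices are available. *)

Require Import Defs.
From HB Require Import structures.
From mathcomp Require Import all_boot all_order all_algebra.
From mathcomp Require Import ring zify.

Set Implicit Arguments.
Unset Strict Implicit.
Unset Printing Implicit Defensive.

Import Order.TTheory GRing.Theory Num.Theory.

Local Open Scope ring_scope.

(** * Closure and counting in a linear triple system: the lower bound *)

Section Families.
Variables (T : finType) (F : {set {set T}}).
Hypothesis linF : linear_triple_system F.

Lemma linear_card3 t : t \in F -> #|t| = 3%N.
Proof. by move=> tF; case/andP: linF => /'forall_implyP H _; apply/eqP/H. Qed.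

Lemma linear_cardI t u : t \in F -> u \in F -> t != u -> (#|t :&: u| <= 1)%N.
Proof.
move=> tF uF tu; case/andP: linF => _ /'forall_implyP/(_ _ tF).
by move=> /'forall_implyP/(_ _ uF)/implyP; apply.
Qed.

(** Grow [A] one neighbour at a time. Each new vertex [z] comes with a triple inside [z |: A] that
    is not inside [A], so the number of vertices minus the number of triples contained never
    increases; it starts from the triples already inside [A]. *)
Lemma exists_closed_superset (A : {set T}) :
  exists W : {set T}, [/\ A \subset W, nbhd F W = set0 &
    (#|W| + #|[set t in F | t \subset A]| <= #|A| + #|F|)%N].
Proof.
have [k] := ubnP #|~: A|; elim: k A => // k IH A.
have [A0 _|[z]] := set_0Vmem (nbhd F A).
  exists A; split=> //; rewrite leq_add2l subset_leq_card //.
  by apply/subsetP => t; rewrite inE => /andP[].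
rewrite inE => /andP[zA] /exists_inP[x xA] /exists_inP[y yA] /andP[_ xyzF] Ak.
have [|W [AW W0 cW]] := IH (z |: A).
  rewrite -ltnS; apply: leq_trans Ak; rewrite ltnS proper_card //.
  by rewrite properE setCS subsetUr setCS subUset sub1set (negPf zA).
exists W; split=> //; first exact: subset_trans (subsetUr _ _) AW.
move: cW; rewrite cardsU1 zA add1n.
suff : (#|[set t in F | t \subset A]| <
        #|[set t in F | t \subset z |: A]|)%N by lia.
apply: proper_card; apply/properP; split.
  apply/subsetP => t; rewrite !inE => /andP[-> tA] /=.
  exact: subset_trans tA (subsetUr _ _).
exists [set x; y; z]; rewrite inE xyzF /=.
  by apply/subsetP => w; rewrite !inE => /orP[/orP[]|] /eqP->;
    rewrite ?xA ?yA ?eqxx ?orbT.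
by apply: contra zA => /subsetP; apply; rewrite !inE eqxx !orbT.
Qed.

Lemma weakly_spreading_card_ge :
  weakly_spreading F -> (1 < #|F|)%N -> #|T| <> 6%N -> (#|T| <= #|F| + 3)%N.
Proof.
move=> wF F1 T6.
have spread t u : t \in F -> u \in F -> t != u -> cl F (t :|: u) = [set: T].
  move=> tF uF tu; have /forallP/(_ [set t; u]) := wF.
  rewrite cards2 tu subUset !sub1set tF uF /= => /eqP <-.
  by congr cl; rewrite /cover bigcup_setU !big_set1.
have [|] := boolP [exists t in F, exists u in F, (t != u) && (t :&: u != set0)].
  move=> /exists_inP[t tF] /exists_inP[u uF] /andP[tu tu0].
  have [W [AW W0 cW]] := exists_closed_superset (t :|: u).
  have WT : W = [set: T].
    by apply/eqP; rewrite -subTset -(spread _ _ tF uF tu) cl_min.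
  (* Both starting triples lie inside their union, which by linearity has 5 vertices: this gives |V|
     + 2 <= 5 + |F|. *)
  have : (#|[set t; u]| <= #|[set s in F | s \subset t :|: u]|)%N.
    apply: subset_leq_card; apply/subsetP => s; rewrite !inE.
    by case/orP => /eqP->; rewrite ?tF ?uF ?subsetUl ?subsetUr.
  move: cW; rewrite WT cardsT cards2 tu cardsU (linear_card3 tF) (linear_card3 uF).
  by move: tu0; rewrite -card_gt0; lia.
move=> /exists_inPn disj; case: T6.
have [t [u [tF uF tu]]] := card_gt1P F1.
have dis s s' : s \in F -> s' \in F -> s != s' -> s :&: s' = set0.
  move=> sF sF' ss; apply/eqP/negPn/negP => ss0.
  by have /exists_inPn/(_ _ sF') := disj _ sF; rewrite ss ss0.
(* A triple adding [z] differs from [t] and [u], as both miss [z], yet it meets one of them in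
   [x]. *)
have W0 : nbhd F (t :|: u) = set0.
  apply/setP => z; rewrite !inE; apply/negP => /andP[].
  rewrite negb_or => /andP[zt zu] /exists_inP[x xtu] /exists_inP[y _].
  move=> /andP[_ sF]; set s := [set x; y; z] in sF.
  have zs : z \in s by rewrite !inE eqxx !orbT.
  have xs : x \in s by rewrite !inE eqxx.
  have ne (v : {set T}) : z \notin v -> v != s by apply: contraNneq => ->.
  case/setUP: xtu => [xt|xu].
    by have /setP/(_ x) := dis _ _ tF sF (ne _ zt); rewrite in_setI xt xs in_set0.
  by have /setP/(_ x) := dis _ _ uF sF (ne _ zu); rewrite in_setI xu xs in_set0.
have := cl_min (subxx (t :|: u)) W0; rewrite spread // subTset => /eqP WT.
by rewrite -cardsT -WT cardsU dis // cards0 (linear_card3 tF) (linear_card3 uF).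
Qed.

End Families.

(** Any admissible subfamily contains two distinct triples, and its closure is a closed set
    containing both. *)
Lemma weakly_spreading_of_closed (T : finType) (F : {set {set T}}) :
  (forall t u (W : {set T}), t \in F -> u \in F -> t != u -> t \subset W ->
    u \subset W -> nbhd F W = set0 -> W = [set: T]) ->
  weakly_spreading F.
Proof.
move=> H; apply/forallP => G; apply/implyP => /andP[/subsetP GF].
move=> /card_gt1P[t [u [tG uG tu]]]; apply/eqP.
apply: (H t u) => //; rewrite ?cl_closed ?GF //.
  exact: subset_trans (bigcup_sup _ tG) (sub_cl _ _).
exact: subset_trans (bigcup_sup _ uG) (sub_cl _ _).
Qed.

(** * Relabelling the vertices along a bijection *)

Section Transport.
Variables (T T' : finType) (f : T -> T') (F : {set {set T}}).
Hypothesis f_bij : bijective f.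
Let fF := [set f @: (t : {set T}) | t in F].

Lemma linear_imset : linear_triple_system F -> linear_triple_system fF.
Proof.
have f_inj := bij_inj f_bij.
move=> lF; apply/andP; split; apply/'forall_implyP => _ /imsetP[t tF ->].
  by rewrite card_imset // (linear_card3 lF).
apply/'forall_implyP => _ /imsetP[u uF ->]; apply/implyP => tu.
rewrite -imsetI; last by move=> x y _ _ /f_inj.
by rewrite card_imset // (linear_cardI lF) //; apply: contraNneq tu => ->.
Qed.

Lemma nbhd_preimset (W : {set T'}) : nbhd fF W = set0 -> nbhd F (f @^-1: W) = set0.
Proof.
move=> W0; apply/setP => z; rewrite !inE; apply/negP => /andP[zW].
move=> /exists_inP[x xW] /exists_inP[y yW] /andP[xy sF].
suff : f z \in nbhd fF W by rewrite W0 inE.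
rewrite inE zW; apply/exists_inP; exists (f x); first by rewrite inE in xW.
apply/exists_inP; exists (f y); first by rewrite inE in yW.
rewrite (inj_eq (bij_inj f_bij)) xy; apply/imsetP; exists [set x; y; z] => //.
by rewrite !imsetU !imset_set1.
Qed.

Lemma weakly_spreading_imset : weakly_spreading F -> weakly_spreading fF.
Proof.
move=> wF; apply: weakly_spreading_of_closed => t' u' W.
move=> /imsetP[t tF ->] /imsetP[u uF ->] tu; rewrite !sub_imset_pre => tW uW /nbhd_preimset W0.
have tu' : t != u by apply: contraNneq tu => ->.
have /forallP/(_ [set t; u]) := wF.
rewrite cards2 tu' subUset !sub1set tF uF /= /cover bigcup_setU !big_set1 => /eqP clT.
have tuW : t :|: u \subset f @^-1: W by rewrite subUset tW.
have := cl_min tuW W0; rewrite clT => /subsetP sub; apply/setP => x; rewrite inE.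
by case: f_bij => g _ fK; have := sub (g x); rewrite !inE fK; apply.
Qed.

End Transport.

(** * Linear triple systems from a symmetric ternary relation *)

Lemma set3C (T : finType) (a b c : T) : [set a; b; c] = [set b; a; c].
Proof. by rewrite (setUC [set a]). Qed.

Lemma set3_rot (T : finType) (a b c : T) : [set a; b; c] = [set b; c; a].
Proof. by apply/setP => w; rewrite !inE -orbA orbC. Qed.

Section Relation.
Variables (V : finType) (L : V -> V -> V -> bool).

Definition triples : {set {set V}} :=
  [set [set p.1.1; p.1.2; p.2] | p : V * V * V & L p.1.1 p.1.2 p.2].

Hypothesis Lrot : forall p q r, L p q r -> L q r p.
Hypothesis Lswap : forall p q r, L p q r -> L q p r.
Hypothesis Lneq : forall p q r, L p q r -> p != q.
Hypothesis Lfun : forall p q r s, L p q r -> L p q s -> r = s.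

Lemma mem_triples p q r : L p q r -> [set p; q; r] \in triples.
Proof. by move=> pqr; apply/imsetP; exists (p, q, r); rewrite ?inE. Qed.

Lemma triplesP t : t \in triples -> exists p q r, L p q r /\ t = [set p; q; r].
Proof. by case/imsetP => -[[p q] r]; rewrite inE /= => pqr ->; exists p, q, r. Qed.

Lemma triples_pair t x y : t \in triples -> x \in t -> y \in t -> x != y ->
  exists2 z, L x y z & t = [set x; y; z].
Proof.
case/triplesP => [p [q [r [pqr ->]]]].
have qrp := Lrot pqr; have rpq := Lrot qrp.
rewrite !inE => /orP[/orP[]|] /eqP-> /orP[/orP[]|] /eqP->; rewrite ?eqxx // => _.
- by exists r.
- by exists q; [exact: Lswap | rewrite 2!set3_rot set3C].
- by exists r; [exact: Lswap | rewrite set3C].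
- by exists p; [| rewrite set3_rot].
- by exists q; [| rewrite 2!set3_rot].
- by exists p; [exact: Lswap | rewrite set3_rot set3C].
Qed.

Lemma triples_linear : linear_triple_system triples.
Proof.
apply/andP; split; apply/'forall_implyP => t tF.
  have [p [q [r [pqr ->]]]] := triplesP tF.
  have qr := Lneq (Lrot pqr); have rp := Lneq (Lrot (Lrot pqr)).
  by rewrite setUC cardsU1 cards2 (Lneq pqr) !inE negb_or rp (eq_sym r) qr.
apply/'forall_implyP => u uF; apply/implyP; apply: contraNT; rewrite -ltnNge.
case/card_gt1P => x [y []]; rewrite !inE => /andP[xt xu] /andP[yt yu] xy.
have [z xyz ->] := triples_pair tF xt yt xy.
by have [w xyw ->] := triples_pair uF xu yu xy; rewrite (Lfun xyz xyw).
Qed.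

Lemma triples_closed (W : {set V}) p q r :
  nbhd triples W = set0 -> L p q r -> p \in W -> q \in W -> r \in W.
Proof.
move=> W0 pqr pW qW; apply/negPn/negP => rW.
suff : r \in nbhd triples W by rewrite W0 inE.
rewrite inE rW; apply/exists_inP; exists p => //; apply/exists_inP; exists q => //.
by rewrite (Lneq pqr) mem_triples.
Qed.

End Relation.

(** * Arithmetic of the four cyclic layers *)

Lemma Z4_cases (i j : 'Z_4) :
  [\/ j = i, j = i + 1, j = i + 1 + 1 | j = i + 1 + 1 + 1].
Proof.
have -> : j = i + (j - i) by ring.
case: (j - i) => [[|[|[|[|//]]]] lt].
- by constructor 1; apply/val_inj; rewrite /= addn0 modn_small.
- by constructor 2; congr (_ + _); apply/val_inj.
- by constructor 3; rewrite -addrA; congr (_ + _); apply/val_inj.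
- by constructor 4; rewrite -!addrA; congr (_ + _); apply/val_inj.
Qed.

Lemma Z4_add4 (i : 'Z_4) : i + 1 + 1 + 1 + 1 = i.
Proof. by apply/val_inj; case: i => [[|[|[|[|//]]]]]. Qed.

Definition parity (i : 'Z_4) : bool := odd i.
Arguments parity : simpl never.

Lemma parityS (i : 'Z_4) : parity (i + 1) = ~~ parity i.
Proof. by case: i => [[|[|[|[|//]]]]]. Qed.

Lemma Z4_neq1 (i : 'Z_4) : ((i + 1 == i) = false) * ((i == i + 1) = false).
Proof. by case: i => [[|[|[|[|//]]]]]. Qed.

Lemma Z4_neq2 (i : 'Z_4) :
  ((i + 1 + 1 == i) = false) * ((i == i + 1 + 1) = false).
Proof. by case: i => [[|[|[|[|//]]]]]. Qed.

Lemma Z4_neq3 (i : 'Z_4) :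
  ((i + 1 + 1 + 1 == i) = false) * ((i == i + 1 + 1 + 1) = false).
Proof. by case: i => [[|[|[|[|//]]]]]. Qed.

Definition Z4_eqE := (Z4_neq1, Z4_neq2, Z4_neq3, Z4_add4).

(** * The hubs and their lines *)

Section Hubs.
Variables (R : finComNzRingType) (h : R).

(* Layers Z_4 x R and two points at infinity; h is the inverse of 2. *)
Definition hub : finType := ('Z_4 * R + bool)%type.

Definition pt (i : 'Z_4) (x : R) : hub := inl (i, x).

(** The shift by 1 keeps the midpoint of [x] and [x] at [x + 1], where the vertical line leads. For
    fixed [x], [refl x] is the inverse of [mid x]. *)
Definition mid (x y : R) : R := h * (x + y) + 1.

Definition refl (x y : R) : R := 2 * (y - 1) - x.

(** In the exceptional case the reflection of [x] in [y] is [x] itself, and the line is completed at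
    infinity instead. *)
Definition back (i : 'Z_4) (x y : R) : hub :=
  if y == x + 1 then inr (parity i) else pt i (refl x y).

(* The third hub on the line through two hubs, if there is such a line. *)
Definition third (p q : hub) : option hub :=
  match p, q with
  | inl (i, x), inl (j, y) =>
      if j == i then if y == x then None else Some (pt (i + 1) (mid x y))
      else if j == i + 1 then Some (back i x y)
      else if j == i + 1 + 1 + 1 then Some (back j y x)
      else None
  | inl (i, x), inr b | inr b, inl (i, x) =>
      Some (if parity i == b then pt (i + 1) (x + 1) else pt (i + 1 + 1 + 1) (x - 1))
  | inr _, inr _ => None
  end.

Definition hline (p q r : hub) : bool := third p q == Some r.

Hypothesis hh : 2 * h = 1.

Lemma half_double (x : R) : h * (2 * x) = x.
Proof. by rewrite mulrA [h * 2]mulrC hh mul1r. Qed.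

Lemma double_half (x : R) : 2 * (h * x) = x.
Proof. by rewrite mulrA hh mul1r. Qed.

Lemma mid_refl x y : mid x (refl x y) = y.
Proof.
rewrite /mid /refl (_ : x + _ = 2 * (y - 1)); last by ring.
by rewrite half_double subrK.
Qed.

Lemma refl_mid x y : refl x (mid x y) = y.
Proof. by rewrite /refl /mid addrK double_half addrC addKr. Qed.

Lemma reflK y : involutive (refl^~ y).
Proof. by move=> x; rewrite /refl; ring. Qed.

Lemma midC x y : mid x y = mid y x.
Proof. by rewrite /mid (addrC x). Qed.

Lemma mid_eq x y z : (mid x y == mid x z) = (y == z).
Proof. by apply/eqP/eqP => [/(congr1 (refl x))|->//]; rewrite !refl_mid. Qed.

Lemma mid_id x : mid x x = x + 1.
Proof. by rewrite /mid (_ : x + x = 2 * x) ?half_double; last ring. Qed.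

Lemma mid_eqS x y : (mid x y == x + 1) = (y == x).
Proof. by rewrite -(mid_id x) mid_eq. Qed.

Lemma refl_eq x y : (refl x y == x) = (y == x + 1).
Proof. by rewrite -(mid_eqS x) mid_refl. Qed.

Lemma thirdC p q : third p q = third q p.
Proof.
case: p q => [[i x]|b] [[j y]|b'] //=.
case: (Z4_cases i j) => -> /=; rewrite ?(Z4_eqE, eqxx) //.
by rewrite eq_sym midC; case: eqP.
Qed.

(** Together with [thirdC] this makes [hline] invariant under all permutations of its arguments. *)
Lemma third_swap p q r : third p q = Some r -> third p r = Some q.
Proof.
case: p q => [[i x]|b] [[j y]|b'] //=.
  case: (Z4_cases i j) => -> /=; rewrite ?(Z4_eqE, eqxx) //.
  - case: (eqVneq y x) => //= yx [<-] /=; rewrite ?(Z4_eqE, eqxx).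
    by rewrite /back mid_eqS (negPf yx) refl_mid.
  - rewrite /back; case: (eqVneq y (x + 1)) => [-> | yx] [<-] /=.
      by rewrite eqxx.
    by rewrite eqxx refl_eq (negPf yx) mid_refl.
  rewrite /back; case: (eqVneq x (y + 1)) => [-> | xy] [<-] /=.
    by rewrite !parityS negbK; case: parity; rewrite //= addrK.
  rewrite ?(Z4_eqE, eqxx) /back -(refl_eq (refl y x)) (reflK x y).
  by rewrite eq_sym refl_eq (negPf xy).
- case: ifP => [/eqP <- | pb] [<-] /=; rewrite ?(Z4_eqE, eqxx) /back ?eqxx //.
  by rewrite subrK eqxx !parityS negbK; case: parity pb; case: b'.
- case: ifP => [/eqP <- | pb] [<-] /=.
    by rewrite parityS; case: parity; rewrite ?Z4_add4 /= addrK.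
  by rewrite !parityS negbK; case: parity pb; case: b => //= _; rewrite Z4_add4 subrK.
Qed.

Lemma hlineC p q r : hline p q r -> hline q p r.
Proof. by rewrite /hline thirdC. Qed.

Lemma hline_rot p q r : hline p q r -> hline q r p.
Proof. by rewrite /hline (thirdC p q) => /eqP/third_swap ->. Qed.

Lemma hline_fun p q r s : hline p q r -> hline p q s -> r = s.
Proof. by move=> /eqP E /eqP; rewrite E => -[]. Qed.

Lemma hline_neq p q r : hline p q r -> p != q.
Proof.
by apply: contraTneq => ->; rewrite /hline; case: q => [[i x]|b] /=; rewrite ?eqxx.
Qed.

Lemma hlineP p q r : hline p q r ->
  (exists i x y, x != y /\
     [set p; q; r] = [set pt i x; pt i y; pt (i + 1) (mid x y)]) \/
  (exists i x,
     [set p; q; r] = [set pt i x; pt (i + 1) (x + 1); inr (parity i)]).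
Proof.
have adj i x y s : third (pt i x) (pt (i + 1) y) = Some s -> 
  (exists i' x' y', x' != y' /\ [set pt i x; pt (i + 1) y; s] =
     [set pt i' x'; pt i' y'; pt (i' + 1) (mid x' y')]) \/
  (exists i' x', [set pt i x; pt (i + 1) y; s] = 
     [set pt i' x'; pt (i' + 1) (x' + 1); inr (parity i')]).
  rewrite /= !(Z4_eqE, eqxx) /back; case: (eqVneq y (x + 1)) => [-> [<-] | xy [<-]].
    by right; exists i, x.
  left; exists i, x, (refl x y); rewrite eq_sym refl_eq xy mid_refl.
  by rewrite -set3_rot set3C.
have inf i x b s : third (pt i x) (inr b) = Some s -> exists i' x', 
    [set pt i x; inr b; s] = [set pt i' x'; pt (i' + 1) (x' + 1); inr (parity i')].
  rewrite /=; case: ifP => [/eqP <- | pb] [<-].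
    by exists i, x; rewrite set3C set3_rot.
  exists (i + 1 + 1 + 1), (x - 1); rewrite -set3_rot subrK Z4_add4.
  rewrite !parityS negbK; congr [set _; _; inr _].
  by case: parity pb; case: b.
move=> /eqP; case: p q => [[i x]|b] [[j y]|b'] //.
- case: (Z4_cases i j) => ->; last 1 first.
  + by rewrite thirdC set3C; have := adj (i + 1 + 1 + 1) y x r; rewrite Z4_add4.
  + rewrite /= !(Z4_eqE, eqxx); case: (eqVneq y x) => //= yx [<-].
    by left; exists i, x, y; rewrite eq_sym.
  + exact: adj.
  + by rewrite /= !(Z4_eqE, eqxx).
- by right; apply: inf.
- by rewrite thirdC set3C; right; apply: inf.
Qed.

(** * Sets of hubs closed under lines *)

Section Closed.
Variable S : {set hub}.
Hypothesis S_closed : forall p q r, hline p q r -> p \in S -> q \in S -> r \in S.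
Hypothesis R_gen : forall x : R, exists k, x = k%:R.

Lemma closed_mid i x y : pt i x \in S -> pt i y \in S -> x != y ->
  pt (i + 1) (mid x y) \in S.
Proof.
move=> xS yS xy; apply: S_closed xS yS.
by rewrite /hline /= eqxx (eq_sym y) (negPf xy).
Qed.

Lemma closed_refl i x y : pt i x \in S -> pt (i + 1) y \in S -> pt i (refl x y) \in S.
Proof.
move=> xS yS; have [yx | yx] := eqVneq y (x + 1).
  by move/eqP: yx; rewrite -refl_eq => /eqP->.
by apply: S_closed xS yS; rewrite /hline /= !(Z4_eqE, eqxx) /back (negPf yx).
Qed.

Lemma closed_inf i x : pt i x \in S -> pt (i + 1) (x + 1) \in S -> inr (parity i) \in S.
Proof.
by move=> xS yS; apply: S_closed xS yS; rewrite /hline /= !(Z4_eqE, eqxx) /back eqxx.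
Qed.

Lemma closed_up i x : inr (parity i) \in S -> pt i x \in S -> pt (i + 1) (x + 1) \in S.
Proof.
by move=> iS xS; apply: S_closed iS xS; rewrite /hline /= eqxx.
Qed.

Lemma closed_down i x : inr (parity i) \in S -> pt (i + 1) x \in S -> pt i (x - 1) \in S.
Proof.
move=> iS xS; apply: S_closed iS xS; rewrite /hline /= parityS Z4_add4.
by case: parity.
Qed.

Lemma full_infs i j x : inr (parity i) \in S -> inr (parity (i + 1)) \in S ->
  pt j x \in S -> S = setT.
Proof.
move=> iS iS' xS.
have inf b : inr b \in S by move: iS iS'; rewrite parityS; case: parity; case: b.
have up k : pt (j + k%:R) (x + k%:R) \in S.
  elim: k => [|k IH]; first by rewrite !addr0.
  by rewrite -!natr1 !addrA closed_up.
have up0 i' : exists y, pt i' y \in S.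
  have := up (i' - j)%R; rewrite natr_Zp addrC subrK.
  by exists (x + (i' - j)%R%:R).
have up4 i' y k : pt i' y \in S -> pt i' (y + 4 * k%:R) \in S.
  move=> yS; elim: k => [|k IH]; first by rewrite mulr0 addr0.
  rewrite -natr1 -{1}(Z4_add4 i') (_ : y + _ = y + 4 * k%:R + 1 + 1 + 1 + 1); last by ring.
  by rewrite !closed_up.
apply/setP => -[[i' z]|b]; last by rewrite inf inE.
(* [k] represents (z - y)/4: going once around the four layers adds 4, and [h * h] is the inverse of
   4. *)
rewrite inE; have [y yS] := up0 i'; have [k Ek] := R_gen (h * (h * (z - y))).
have := up4 _ _ k yS; rewrite -Ek (_ : 4 * _ = 2 * (h * 2 * (h * (z - y)))).
  by rewrite [h * 2]mulrC hh mul1r double_half addrC subrK.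
by ring.
Qed.


(** With m the midpoint of [x] and [y], reflections in [w] and m produce [x + d] and [x - d] for d =
    2(w - m). Their midpoint is [x + 1], so the vertical line at [x] has two points in [S] and its
    point at infinity follows. *)
Lemma closed_inf_off_mid i x y w : pt i x \in S -> pt i y \in S -> x != y ->
  pt (i + 1) w \in S -> w != mid x y -> inr (parity i) \in S.
Proof.
move=> xS yS xy wS wm; have mS := closed_mid xS yS xy.
have [d dE] : exists d, d = 2 * (w - mid x y) by eexists.
have twice (z : R) : (2 * z == 0) = (z == 0).
  by apply/eqP/eqP => [/(congr1 ( *%R h))|->]; rewrite ?half_double ?mulr0.
have d0 : d != 0 by rewrite dE twice subr_eq0.
have yE : y = refl x (mid x y) by rewrite refl_mid.
have xdS : pt i (x + d) \in S.
  suff <- : refl y w = x + d by apply: closed_refl.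
  by rewrite {1}yE /refl dE; ring.
have xdS' : pt i (x - d) \in S.
  suff <- : refl (refl x w) (mid x y) = x - d by apply/closed_refl/mS/closed_refl.
  by rewrite /refl dE; ring.
apply: (@closed_inf i x) => //; suff <- : mid (x + d) (x - d) = x + 1.
  apply: closed_mid => //; rewrite -subr_eq0.
  suff -> : x + d - (x - d) = 2 * d by rewrite twice.
  by ring.
by rewrite -(mid_id x) /mid; congr (h * _ + 1); ring.
Qed.

(** The first point at infinity lifts [x] and [y] one layer. There [x + 1] and [mid x y] form a new
    pair, and the midpoint of [x + 1] and [y + 1] lies off theirs, which yields the second point at
    infinity. *)
Lemma full_off_mid i x y w : pt i x \in S -> pt i y \in S -> x != y ->
  pt (i + 1) w \in S -> w != mid x y -> S = setT.
Proof.
move=> xS yS xy wS wm; have iS := closed_inf_off_mid xS yS xy wS wm.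
have mS := closed_mid xS yS xy; have xS' := closed_up iS xS; have yS' := closed_up iS yS.
have xm : x + 1 != mid x y by rewrite eq_sym mid_eqS eq_sym.
apply: (full_infs (i := i) iS _ xS); apply: (closed_inf_off_mid xS' mS xm (closed_mid xS' yS' _)).
  by rewrite (inj_eq (addIr _)).
by rewrite mid_eq midC eq_sym mid_eqS.
Qed.

Lemma full_inf_pred i x y : pt (i + 1) x \in S -> pt (i + 1) y \in S -> x != y ->
  inr (parity i) \in S -> S = setT.
Proof.
move=> xS yS xy iS; apply: (full_off_mid (closed_down iS xS) (closed_down iS yS) _ xS _).
  by rewrite (inj_eq (addIr _)).
have := mid_eqS (x - 1) (y - 1); rewrite subrK eq_sym => ->.
by rewrite (inj_eq (addIr _)) eq_sym.
Qed.

Lemma full_mid_line i x y d : pt i x \in S -> pt i y \in S -> x != y -> d \in S ->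
  d \notin [set pt i x; pt i y; pt (i + 1) (mid x y)] -> S = setT.
Proof.
move=> xS yS xy dS; rewrite !inE !negb_or -andbA => /and3P[dx dy dm].
have mS := closed_mid xS yS xy.
have adj w : pt (i + 1) w \in S -> w != mid x y -> S = setT.
  exact: (full_off_mid xS yS xy).
(* Layer [i] lies above layer [i + 3], whose vertical lines pass through this point at infinity. *)
have back : inr (~~ parity i) \in S -> S = setT.
  have := @full_inf_pred (i + 1 + 1 + 1) x y.
  by rewrite !parityS negbK Z4_add4; apply.
case: d dS dx dy dm => [[j z]|b] dS dx dy dm; last first.
  have [bi | bi] := eqVneq b (parity i); last first.
    by apply: back; case: b bi dS {dx dy dm}; case: parity.
  rewrite bi in dS; apply: (adj (x + 1) (closed_up dS xS)).
  by rewrite eq_sym mid_eqS eq_sym.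
case: (Z4_cases i j) => jE; rewrite {}jE in dS dx dy dm.
- have zx : x != z by apply: contraNneq dx => ->.
  apply: (adj (mid x z)); first exact: closed_mid.
  by rewrite mid_eq; apply: contraNneq dy => ->.
- by apply: (adj _ dS); apply: contraNneq dm => ->.
(* Two layers up, [d] either reflects the midpoint to a second point of layer [i + 1], or lies
   vertically above it and gives the other point at infinity. *)
- have [zm | zm] := eqVneq z (mid x y + 1); last first.
    by apply: (adj (refl (mid x y) z)); [exact: closed_refl | rewrite refl_eq].
  by apply: back; rewrite -parityS; apply: closed_inf mS _; rewrite -zm.
(* One layer down, reflecting [z] in [x] and in [y] gives two distinct points; at most one of [x],
   [y] is their midpoint, and the other is off it. *)
set k := i + 1 + 1 + 1 in dS *; have ki : k + 1 = i by rewrite /k Z4_add4.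
have xS' : pt (k + 1) x \in S by rewrite ki.
have yS' : pt (k + 1) y \in S by rewrite ki.
have uv : refl z x != refl z y by rewrite -(mid_eq z) !mid_refl.
have full w : pt (k + 1) w \in S -> w != mid (refl z x) (refl z y) -> S = setT.
  exact: (full_off_mid (closed_refl dS xS') (closed_refl dS yS') uv).
have [E | /full] := eqVneq x (mid (refl z x) (refl z y)); last exact.
by apply: (full _ yS'); rewrite -E eq_sym.
Qed.

Lemma full_vertical_line i x d : pt i x \in S -> pt (i + 1) (x + 1) \in S -> d \in S ->
  d \notin [set pt i x; pt (i + 1) (x + 1); inr (parity i)] -> S = setT.
Proof.
move=> xS xS' dS; rewrite !inE !negb_or -andbA => /and3P[dx dx' di].
have iS := closed_inf xS xS'.
have same z : pt i z \in S -> z != x -> S = setT.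
  move=> zS zx; apply: (full_off_mid zS xS zx xS' _).
  by rewrite eq_sym midC mid_eqS.
have next z : pt (i + 1) z \in S -> z != x + 1 -> S = setT.
  move=> zS zx; apply: (same _ (closed_down iS zS)).
  by rewrite -(inj_eq (addIr 1)) subrK.
(* Either two consecutive vertical lines supply both points at infinity, or a reflection gives a
   second point in layer [i + 1]. *)
have opp z : pt (i + 1 + 1) z \in S -> S = setT.
  move=> zS; have [zx | zx] := eqVneq z (x + 1 + 1).
    by rewrite zx in zS; exact: (full_infs iS (closed_inf xS' zS) xS).
  by apply: (next _ (closed_refl xS' zS)); rewrite refl_eq.
case: d dS dx dx' di => [[j z]|b] dS dx dx' di; last first.
  apply: (full_infs iS _ xS); rewrite parityS; suff <- : b = ~~ parity i by [].
  by move: di; rewrite (inj_eq (@inr_inj _ _)); case: b {dS dx dx'}; case: parity.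
case: (Z4_cases i j) => jE; rewrite {}jE in dS dx dx' di.
- by apply: (same _ dS); apply: contraNneq dx => ->.
- by apply: (next _ dS); apply: contraNneq dx' => ->.
- exact: (opp _ dS).
- by apply: (opp _ (closed_down _ dS)); rewrite !parityS negbK.
Qed.

Lemma full_line p q r d : hline p q r -> p \in S -> q \in S -> d \in S ->
  d \notin [set p; q; r] -> S = setT.
Proof.
move=> pqr pS qS; have rS := S_closed pqr pS qS.
have sub : [set p; q; r] \subset S by rewrite !subUset !sub1set pS qS rS.
case: (hlineP pqr) => [[i [x [y [xy E]]]]|[i [x E]]];
  rewrite {}E in sub *; move: sub; rewrite !subUset !sub1set => /andP[/andP[uS vS] _] dS.
  exact: full_mid_line.
exact: full_vertical_line.
Qed.

Lemma full_opposite i x y d : pt i x \in S -> pt (i + 1 + 1) y \in S -> d \in S ->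
  d != pt i x -> d != pt (i + 1 + 1) y -> S = setT.
Proof.
have same i' x' y' z : pt i' x' \in S -> pt (i' + 1 + 1) y' \in S ->
    pt i' z \in S -> z != x' -> S = setT.
  move=> xS yS zS zx; apply: (full_mid_line zS xS zx yS).
  by rewrite !inE /pt !(inj_eq (@inl_inj _ _)) !xpair_eqE !Z4_eqE.
have next i' x' y' z : pt i' x' \in S -> pt (i' + 1 + 1) y' \in S ->
    pt (i' + 1) z \in S -> S = setT.
  move=> xS yS zS; have [zx | zx] := eqVneq z (x' + 1).
    rewrite zx in zS; apply: (full_vertical_line xS zS yS).
    by rewrite !inE /pt !(inj_eq (@inl_inj _ _)) !xpair_eqE !Z4_eqE.
  by apply: (same _ _ _ _ xS yS (closed_refl xS zS)); rewrite refl_eq.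
(* As [i + 4 = i], the two opposite hubs may exchange roles, which settles layers [i + 2] and
   [i + 3]. *)
move=> xS yS; have xS' : pt (i + 1 + 1 + 1 + 1) x \in S by rewrite Z4_add4.
case: d => [[j z]|b] dS dx dy; last first.
  have [bi | bi] := eqVneq b (parity i).
    rewrite bi in dS; exact: (next _ _ _ _ xS yS (closed_up dS xS)).
  have iS : inr (parity (i + 1)) \in S.
    by rewrite parityS; case: b bi dS {dx dy}; case: parity.
  exact: (next _ _ _ _ xS yS (closed_down iS yS)).
case: (Z4_cases i j) => jE; rewrite {}jE in dS dx dy.
- by apply: (same _ _ _ _ xS yS dS); apply: contraNneq dx => ->.
- exact: (next _ _ _ _ xS yS dS).
- by apply: (same _ _ _ _ yS xS' dS); apply: contraNneq dy => ->.
- exact: (next _ _ _ _ yS xS' dS).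
Qed.

End Closed.

End Hubs.

(** * Lines together with attached vertices *)

Section System.
Variables (R : finComNzRingType) (h : R) (N : nat) (e : 'I_N -> bool * R * R).
Hypothesis hh : 2 * h = 1.
Hypothesis R_gen : forall x : R, exists k, x = k%:R.
Hypothesis e_inj : injective e.

Let hub := hub R.
Let vertex : finType := (hub + 'I_N)%type.

(** The boolean in [e k] selects layer 0 or 1, the target being two layers further; thus each
    unordered pair in opposite layers has a single code. *)
Definition source (k : 'I_N) : hub := pt (e k).1.1%:R (e k).1.2.

Definition target (k : 'I_N) : hub := pt ((e k).1.1%:R + 1 + 1) (e k).2.

Definition joins (k : 'I_N) (p q : hub) : bool :=
  (p == source k) && (q == target k) || (p == target k) && (q == source k).

Definition incident (p q r : vertex) : bool :=
  match p, q, r with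
  | inl a, inl b, inl c => hline h a b c
  | inl a, inl b, inr k | inl b, inr k, inl a | inr k, inl a, inl b => joins k a b
  | _, _, _ => false
  end.

Lemma source_neq_target k l : source k != target l.
Proof. by rewrite /source /target; case: (e k).1.1; case: (e l).1.1. Qed.

Lemma joinsC k p q : joins k p q = joins k q p.
Proof. by rewrite /joins orbC andbC [X in _ || X]andbC. Qed.

Lemma joins_inj k l p q : joins k p q -> joins l p q -> k = l.
Proof.
have inj : source k = source l -> target k = target l -> k = l.
  rewrite /source /target => -[b x] [_ y]; apply: e_inj.
  case: (e k) (e l) b x y => [[b x] y] [[b' x'] y'] /= E -> ->.
  by case: b b' E => -[].
have neq u v : source u = target v -> False.
  by move/eqP; rewrite (negPf (source_neq_target u v)).
case/orP => /andP[/eqP-> /eqP->] /orP[] /andP[/eqP E1 /eqP E2].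
- exact: inj.
- by case: (neq _ _ E1).
- by case: (neq _ _ (esym E1)).
- exact: inj.
Qed.

Lemma joins_fun k p q r : joins k p q -> joins k p r -> q = r.
Proof.
have neq := source_neq_target k k.
by case/orP => /andP[/eqP-> /eqP->] /orP[] /andP[/eqP E1 /eqP->] //;
  rewrite E1 eqxx in neq.
Qed.

(** Opposite layers carry no line, which keeps an attached triple from sharing two hubs with a
    line. *)
Lemma joins_not_hline k p q r : joins k p q -> ~~ hline h p q r.
Proof.
have st s : ~~ hline h (source k) (target k) s.
  by rewrite /hline /= !(Z4_eqE, eqxx).
case/orP => /andP[/eqP-> /eqP->] //.
by apply: contra (st r); exact: hlineC.
Qed.

Lemma incident_rot p q r : incident p q r -> incident q r p.
Proof.
case: p q r => [a|k] [b|k'] [c|k''] //=; exact: hline_rot.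
Qed.

Lemma incidentC p q r : incident p q r -> incident q p r.
Proof.
case: p q r => [a|k] [b|k'] [c|k''] //=; first exact: hlineC.
all: by rewrite joinsC.
Qed.

Lemma incident_neq p q r : incident p q r -> p != q.
Proof.
case: p q r => [a|k] [b|k'] [c|k''] //=.
  by move/hline_neq; rewrite (inj_eq (@inl_inj _ _)).
rewrite (inj_eq (@inl_inj _ _)) => /orP[] /andP[/eqP-> /eqP->].
  exact: source_neq_target.
by rewrite eq_sym source_neq_target.
Qed.

Lemma incident_fun p q r s : incident p q r -> incident p q s -> r = s.
Proof.
case: p q r s => [a|k] [b|k'] [c|k''] [d|l] //=.
- by move=> H /(hline_fun H) ->.
- by move=> H /(@joins_not_hline _ _ _ c); rewrite H.
- by move=> /(@joins_not_hline _ _ _ d)/negP H /H.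
- by move=> H /(joins_inj H) ->.
- by rewrite ![joins _ _ a]joinsC => H /(joins_fun H) ->.
- by move=> H /(joins_fun H) ->.
Qed.

Let F := triples incident.

Lemma system_linear : linear_triple_system F.
Proof.
exact: triples_linear incident_rot incidentC incident_neq incident_fun.
Qed.

Lemma two_hubs t : t \in F -> exists a b : hub, [/\ inl a \in t, inl b \in t & a != b].
Proof.
case/triplesP => [p [q [r [pqr ->]]]].
have pq := incident_neq pqr; have qr := incident_neq (incident_rot pqr).
have rp := incident_neq (incident_rot (incident_rot pqr)).
case: p q r pqr pq qr rp => [a|k] [b|k'] [c|k''] //= _.
- by exists a, b; rewrite !inE !eqxx orbT.
- by exists a, b; rewrite !inE !eqxx orbT.
- by exists c, a; rewrite !inE !eqxx !orbT.
- by exists b, c; rewrite !inE !eqxx !orbT.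
Qed.

Lemma system_spreading : weakly_spreading F.
Proof.
apply: weakly_spreading_of_closed => t u W tF uF tu /subsetP tW /subsetP uW W0.
pose S : {set hub} := inl @^-1: W.
have W_closed := triples_closed incident_neq W0.
have S_closed p q r : hline h p q r -> p \in S -> q \in S -> r \in S.
  by rewrite !inE => pqr; apply: W_closed.
suff ST : S = setT.
  have inS p : inl p \in W by have := in_setT p; rewrite -ST inE.
  apply/setP => -[p|k]; rewrite inE ?inS //.
  by apply: (W_closed (inl (source k)) (inl (target k))); rewrite //= /joins !eqxx.
(* [u] contains two hubs, and by linearity [t] cannot contain both. *)
have [d du dt] : exists2 d : hub, inl d \in u & inl d \notin t.
  have [a [b [au bu ab]]] := two_hubs uF.
  have [aT|] := boolP (inl a \in t); last by exists a.
  have [bT|] := boolP (inl b \in t); last by exists b.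
  have := linear_cardI system_linear tF uF tu; rewrite leqNgt => /negP[].
  apply/card_gt1P; exists (inl a), (inl b).
  by rewrite !inE aT au bT bu (inj_eq (@inl_inj _ _)).
have dS : d \in S by rewrite inE uW.
have [a [b [aT bT ab]]] := two_hubs tF.
have ab' : inl a != inl b :> vertex by rewrite (inj_eq (@inl_inj _ _)).
have tS p : inl p \in t -> p \in S by rewrite inE; apply: tW.
have [[c|k] abr tE] := triples_pair incident_rot incidentC tF aT bT ab'.
  apply: (full_line hh S_closed R_gen abr (tS _ aT) (tS _ bT) dS).
  by move: dt; rewrite tE !inE !(inj_eq (@inl_inj _ _)).
have [sT tT] : inl (source k) \in t /\ inl (target k) \in t.
  by move: abr aT bT => /orP[] /andP[/eqP-> /eqP->].
apply: (full_opposite hh S_closed R_gen (tS _ sT) (tS _ tT) dS).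
  by apply: contraNneq dt => ->.
by apply: contraNneq dt => ->.
Qed.

Lemma system_card_gt1 : (1 < #|F|)%N.
Proof.
have vF (x : R) :
    [set inl (pt 0 x); inl (pt (0 + 1) (x + 1)); inl (inr (parity 0))] \in F.
  by apply: mem_triples; rewrite /= /hline /= /back eqxx.
apply/card_gt1P; eexists; eexists; split; [exact: (vF 0) | exact: (vF 1) |].
apply/eqP => /setP/(_ (inl (pt 0 0))); rewrite !inE eqxx /=.
by rewrite !(inj_eq (@inl_inj _ _)) !xpair_eqE eq_sym oner_eq0.
Qed.

Lemma system_card : (#|F| <= 4 * 'C(#|R|, 2) + 4 * #|R| + N)%N.
Proof.
(* A midpoint line is determined by its layer and an unordered pair; on a two-element set the
   formula with the sum is [mid]. *)
pose g1 (p : 'Z_4 * {set R}) : {set vertex} :=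
  inl @: ([set pt p.1 x | x in p.2] :|: [set pt (p.1 + 1) (h * (\sum_(x in p.2) x) + 1)]).
pose g2 (p : 'Z_4 * R) : {set vertex} :=
  [set inl (pt p.1 p.2); inl (pt (p.1 + 1) (p.2 + 1)); inl (inr (parity p.1))].
pose g3 k : {set vertex} := [set inl (source k); inl (target k); inr k].
pose D := setX [set: 'Z_4] [set A : {set R} | #|A| == 2].
have sub : F \subset g1 @: D :|: g2 @: setT :|: g3 @: setT.
  apply/subsetP => t tF; have [a [b [aT bT ab]]] := two_hubs tF.
  have ab' : inl a != inl b :> vertex by rewrite (inj_eq (@inl_inj _ _)).
  have [[c|k] abr ->] := triples_pair incident_rot incidentC tF aT bT ab'.
    have E : [set inl a; inl b; inl c] = inl @: [set a; b; c] :> {set vertex}.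
      by rewrite !imsetU !imset_set1.
    rewrite E !in_setU; apply/orP; left; apply/orP.
    case: (hlineP hh abr) => [[i [x [y [xy ->]]]]|[i [x ->]]]; [left|right].
      apply/imsetP; exists (i, [set x; y]); first by rewrite !inE cards2 xy.
      rewrite /g1 /= big_setU1 ?inE // big_set1; congr (inl @: (_ :|: _)).
      by rewrite imsetU !imset_set1.
    by apply/imsetP; exists (i, x); rewrite // !imsetU !imset_set1.
  rewrite in_setU; apply/orP; right; apply/imsetP; exists k => //.
  by case/orP: abr => /andP[/eqP-> /eqP->]; rewrite // set3C.
apply: leq_trans (subset_leq_card sub) _.
apply: leq_trans (leq_card_setU _ _) (leq_add _ _); last first.
  by rewrite (leq_trans (leq_imset_card _ _)) // cardsT card_ord.
apply: leq_trans (leq_card_setU _ _) (leq_add _ _); last first.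
  by rewrite (leq_trans (leq_imset_card _ _)) // cardsT card_prod card_ord.
by rewrite (leq_trans (leq_imset_card _ _)) // cardsX cardsT card_ord card_draws.
Qed.

Lemma system_vertex_card : #|{: vertex}| = (4 * #|R| + 2 + N)%N.
Proof. by rewrite !card_sum card_prod card_bool !card_ord. Qed.

End System.

(** * Choice of the parameters *)

Lemma spreading_system_exists (r N : nat) (q := r.*2.+3) : (N <= 2 * (q * q))%N ->
  exists F : {set {set 'I_(4 * q + 2 + N)}},
    [/\ linear_triple_system F, weakly_spreading F, (1 < #|F|)%N &
        (#|F| <= 4 * 'C(q, 2) + 4 * q + N)%N].
Proof.
(* The offset 3 makes q odd and at least 3, so that ['Z_q] is a nontrivial ring with q elements. *)
move=> leN; have card_q : #|'Z_q| = q by rewrite card_ord.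
have leN' : (N <= #|{: bool * 'Z_q * 'Z_q}|)%N.
  by rewrite !card_prod card_q card_bool -mulnA.
pose e (k : 'I_N) : bool * 'Z_q * 'Z_q := enum_val (widen_ord leN' k).
have e_inj : injective e.
  by move=> k l /enum_val_inj/(congr1 val)/= /val_inj.
(* 2(r + 2) = q + 1, so r + 2 inverts 2 modulo q. *)
have hh : 2 * r.+2%:R = 1 :> 'Z_q.
  rewrite -natrM (_ : (2 * r.+2)%N = (1 + q)%N); last by rewrite /q; lia.
  by rewrite natrD (_ : q%:R = 0) ?addr0 //; apply/val_inj; rewrite Zp_nat /= modnn.
have gen (x : 'Z_q) : exists k, x = k%:R by exists x; rewrite natr_Zp.
have cardV := system_vertex_card 'Z_q N; rewrite card_q in cardV.
pose f x := cast_ord cardV (enum_rank x).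
have f_bij : bijective f.
  exists (fun y => enum_val (cast_ord (esym cardV) y)) => x.
    by rewrite /f cast_ordK enum_rankK.
  by rewrite /f enum_valK cast_ordKV.
set F := triples (incident r.+2%:R e).
have cF : #|[set f @: (t : {set _}) | t in F]| = #|F|.
  by rewrite card_imset //; apply: imset_inj; exact: bij_inj f_bij.
exists [set f @: (t : {set _}) | t in F]; rewrite cF; split.
- by apply: linear_imset => //; exact: system_linear.
- by apply: weakly_spreading_imset => //; exact: system_spreading.
- exact: system_card_gt1.
- by rewrite (leq_trans (system_card e hh)) ?card_q.
Qed.

Lemma sparse_spreading_system_exists (n : nat) : (32 < n)%N ->
  exists F : {set {set 'I_n}},
    [/\ linear_triple_system F, weakly_spreading F, (1 < #|F|)%N &
        (3 * #|F| < 8 * n)%N].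
Proof.
(* For q = 2s + 1 the capacity 4q + 2 + 2q^2 equals 8(s + 1)^2. The least sufficient s is taken; n >
   32 forces s >= 2. *)
move=> n32; have ex : exists s, (n <= 8 * (s.+1 * s.+1))%N by exists n; nia.
case: (ex_minnP ex) => [[|[|r]]] n_le s_min; [by lia|by lia|].
have n_gt : (8 * (r.+2 * r.+2) < n)%N.
  by rewrite ltnNge; apply/negP => /s_min; lia.
pose q := r.+1.*2.+3.
have [N nE] : exists N, n = (4 * q + 2 + N)%N.
  by exists (n - (4 * q + 2))%N; rewrite subnKC // /q; nia.
have leN : (N <= 2 * (q * q))%N by move: n_le; rewrite nE /q; nia.
have [F [linF wF F1 cF]] := spreading_system_exists leN.
rewrite -/q -nE in F linF wF F1 cF *; exists F; split=> //.
(* Here |F| <= n + 2q^2 - 2q - 2, while minimality gives n > 2(q - 1)^2; hence 3|F| < 8n. *)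
move: cF; rewrite bin2odd; last by rewrite /q /= odd_double.
rewrite (_ : q.-1./2 = r.+2); last by rewrite /q /=; lia.
by move: n_gt nE; rewrite /q; nia.
Qed.

(* The two bounds on the minimum *)
From mathcomp Require Import all_classical all_reals all_analysis.
Import numFieldNormedType.Exports.

Local Open Scope classical_set_scope.

Theorem theorem3 (R : realType) :
  (forall n : nat, n <> 6%N -> ((n%:R - 3)%:E <= xi_wsp R n)%E) /\
  (exists2 f : nat -> R,
    f =o_\oo (fun n : nat => n%:R : R) &
    \forall n \near \oo, (xi_wsp R n < (8 / 3 * n%:R + f n)%:E)%E).
Proof.
split=> [n n6|].
  apply: le_bigmin => [|F /and3P[linF wF F1]]; first exact: leey.
  rewrite lee_fin lerBlDr -natrD ler_nat.
  by have := weakly_spreading_card_ge linF wF F1; rewrite card_ord; apply.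
(* The bound by 8n/3 is strict from n = 33 on, so the zero error term serves. *)
exists (fun=> 0); first by
  apply/eqoP => eps eps0; apply: nearW => n; rewrite normr0 mulr_ge0 // ltW.
near=> n; have [|F [linF wF F1 cF]] := @sparse_spreading_system_exists n.
  by near: n; exists 33%N.
apply: (@le_lt_trans _ _ (#|F|%:R)%:E).
  by apply: bigmin_le_cond; rewrite linF wF.
rewrite lte_fin addr0 mulrAC ltr_pdivlMr ?ltr0n // -!natrM ltr_nat.
by rewrite mulnC.
Unshelve. all: by end_near.
Qed.
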